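(* Let $n \geq 4$ and let $\mathsf{DIF}(n) := \big(\mathrm{des}_x(\sigma \tau^{-1}) + \mathrm{inv}_y(\sigma \tau^{-1}) + \mathrm{fix}_z(\sigma \tau^{-1})\big)_{\sigma, \tau \in \mathfrak{S}_n}$. Then $\mathsf{DIF}(n)$ is diagonalizable, and its spectrum $\mathrm{Sp}\big(\mathsf{DIF}(n)\big)$ consists of the following five elements, with the following multiplicities: (1) $\frac{n!}{2} \Big( \sum_{i=1}^{n-1} x_i + \sum_{1\le i<j\le n} y_{i,j} \Big) + n!z$, with multiplicity $1$; (2) $-(n-2)! \Big( \sum_{i=1}^{n-1} x_i + \sum_{1\le i<j\le n} (j-i)y_{i,j} - nz \Big)$, with multiplicity $n-1$; (3) $-(n-2)! \sum_{i=1}^{n-1} x_i - (n-3)! \sum_{1\le i<j\le n} \big(n -2(j-i)\big) y_{i,j}$, with multiplicity $\binom{n-1}{2}$; (4) $(n-2)!\,nz$, with multiplicity $(n-1)(n-2)$; (5) $0$, with multiplicity $n! -\frac{n}{2}(3n-7) -3$.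
   Context: $[n]=\{1,\dots,n\}$ and $\mathfrak{S}_n$ is the symmetric group of $[n]$; products are compositions of maps. Let $z$, $x_i$ ($1\le i\le n-1$) and $y_{i,j}$ ($1 \le i<j \le n$) be independent indeterminates over $\mathbb{R}$. For $\sigma\in\mathfrak{S}_n$, $\mathrm{Des}\,\sigma := \{i\in[n-1]\mid \sigma(i)>\sigma(i+1)\}$, $\mathrm{Inv}\,\sigma := \{(i,j)\in[n]^2 \mid i<j,\ \sigma(i)>\sigma(j)\}$, $\mathrm{Fix}\,\sigma := \{i\in[n]\mid \sigma(i)=i\}$, $\mathrm{des}_x\,\sigma := \sum_{i\in\mathrm{Des}\,\sigma} x_i$, $\mathrm{inv}_y\,\sigma := \sum_{(i,j)\in\mathrm{Inv}\,\sigma} y_{i,j}$, and $\mathrm{fix}_z\,\sigma := \#\mathrm{Fix}(\sigma)\, z$. $\mathsf{DIF}(n)$ is an $n!\times n!$ matrix with rows and columns indexed by $\mathfrak{S}_n$ and entries in the polynomial ring over $\mathbb{R}$ in all these indeterminates; it is regarded as a matrix over the field of fractions of that ring. $\mathrm{Sp}(\mathsf{M})$ is the set of eigenvalues of a square matrix $\mathsf{M}$. *)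

(* Defs.v *)
From HB Require Import structures.
From mathcomp Require Import all_boot all_order all_algebra all_fingroup.
From mathcomp Require Import reals.
From mathcomp Require Import mpoly.

Set Implicit Arguments.
Unset Strict Implicit.
Unset Printing Implicit Defensive.

Import GRing.Theory.
Local Open Scope ring_scope.

(* The index set [n] = {1, ..., n} is shifted to 'I_n = {0, ..., n - 1}, and  *)
(* [n - 1] to 'I_n.-1; the shift changes neither the order comparisons nor    *)
(* the differences j - i.                                                     *)

Definition opair (n : nat) := {p : 'I_n * 'I_n | (p.1 < p.2)%N}.

Definition lo n (p : opair n) : 'I_n := (val p).1.
Definition hi n (p : opair n) : 'I_n := (val p).2.

Lemma ltn_ordS n (i : 'I_n.-1) : (i.+1 < n)%N.
Proof. by rewrite -ltn_predRL. Qed.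

Definition posn n (i : 'I_n.-1) : 'I_n := widen_ord (leq_pred n) i.
Definition posS n (i : 'I_n.-1) : 'I_n := Ordinal (ltn_ordS i).

Definition Des n (s : 'S_n) : {set 'I_n.-1} :=
  [set i | (s (posS i) < s (posn i))%N].
Definition Inv n (s : 'S_n) : {set opair n} :=
  [set p | (s (hi p) < s (lo p))%N].
Definition Fix n (s : 'S_n) : {set 'I_n} := [set i | s i == i].

(* The names of the indeterminates: None stands for z, Some (inl i) for x_i   *)
(* and Some (inr (i, j)) for y_(i,j).                                         *)
Definition indet (n : nat) : finType := option ('I_n.-1 + opair n)%type.

Notation polyring R n := {mpoly R[#|indet n|]}.

Section Statistics.
Variables (R : realType) (n : nat).

Definition Z : polyring R n := 'X_(enum_rank (None : indet n)).
Definition X (i : 'I_n.-1) : polyring R n :=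
  'X_(enum_rank (Some (inl i) : indet n)).
Definition Y (p : opair n) : polyring R n :=
  'X_(enum_rank (Some (inr p) : indet n)).

Definition des_x (s : 'S_n) : polyring R n := \sum_(i in Des s) X i.
Definition inv_y (s : 'S_n) : polyring R n := \sum_(p in Inv s) Y p.
Definition fix_z (s : 'S_n) : polyring R n := Z *+ #|Fix s|.

Definition dif (s : 'S_n) : polyring R n := des_x s + inv_y s + fix_z s.

(* In MathComp (s * t)%g maps i to t (s i), so the composition of maps        *)
(* sigma o tau^-1 is written (tau^-1 * sigma)%g.                              *)
Definition DIF : 'M[{fraction (polyring R n)}]_#|{: 'S_n}| :=
  \matrix_(i, j) tofrac (dif ((enum_val j)^-1 * enum_val i)%g).

Definition eig1 : polyring R n :=
  (n`!%:R / 2%:R : R) *: (\sum_i X i + \sum_p Y p) + n`!%:R * Z.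

Definition eig2 : polyring R n :=
  - ((n - 2)`!%:R *
     (\sum_i X i + \sum_p ((hi p)%:R - (lo p)%:R) * Y p - n%:R * Z)).

Definition eig3 : polyring R n :=
  - ((n - 2)`!%:R * \sum_i X i)
  - (n - 3)`!%:R * \sum_p (n%:R - 2%:R * ((hi p)%:R - (lo p)%:R)) * Y p.

Definition eig4 : polyring R n := (n - 2)`!%:R * n%:R * Z.

End Statistics.

Definition multiplicity (F : fieldType) (m : nat) (M : 'M[F]_m) (a : F) : nat :=
  mup a (char_poly M).

(* Main.v *)
Require Import Defs.
From mathcomp Require Import all_boot all_order all_algebra all_fingroup.
From mathcomp Require Import reals.
From mathcomp Require Import mpoly.
From mathcomp Require Import ring zify.

Set Implicit Arguments.
Unset Strict Implicit.
Unset Printing Implicit Defensive.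

Import Order.TTheory GRing.Theory Num.Theory.
Local Open Scope ring_scope.

(* Put eps(a, b) = sign (b - a) and let w be the antisymmetric matrix with     *)
(* w(i, j) = y_(i,j) + [j = i + 1] x_i for i < j, W the sum of the w(i, j),    *)
(* i < j, and D the sum of the (j - i) w(i, j).  The entry of DIF(n) at        *)
(* (s, t) is                                                                   *)
(*   W/2 + z sum_a [s a = t a] - 1/4 sum_(a,b) eps(s a, s b) w(t a, t b).      *)
(* Split eps and w into their parts with zero row sums eps', w' and the        *)
(* gradients of their row sums h, q.  The matrix becomes a combination of      *)
(*   J = (1),    F = (sum_a [s a = t a] - 1),                                  *)
(*   (sum_a h(s a) q(t a)),    (sum_(a,b) eps'(s a, s b) w'(t a, t b)).        *)
(* Averaging over the symmetric group (Schur's lemma for the trivial, the      *)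
(* standard and the exterior square representations) shows that these four     *)
(* are multiples of idempotents; the last one annihilates and is annihilated   *)
(* by all others, J as well, and the third one is absorbed by F.  Hence        *)
(* DIF(n) is a combination of orthogonal idempotents, and the multiplicities   *)
(* are their traces, as the characteristic is 0.                               *)

(** Why these values occur: a kernel that pairs two functions through an irreducible representation
    of dimension d squares to itself times n!/d and their inner product. Here n!/d is n! for the
    constants ([K0_K0]), n (n-2)! for the standard representation, d = n-1 ([K1_mul]), and 2n (n-3)!
    for its exterior square, d = C(n-1,2) ([K2_mul]). If the inner product is nonzero, dividing by
    the scalar gives an idempotent of trace d.

    The fixed-point kernel, once the constant 1 is removed, is a multiple of an idempotent of trace
    (n-1)^2, the projection onto the whole standard isotypic component ([KfixE], [Kfix_Kfix]). The
    standard part of the inversion kernel is an idempotent of trace n-1 inside it ([Kfix_K1],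
    [K1_Kfix]), so the component splits as (n-1) + (n-1)(n-2), and z enters both resulting
    eigenvalues.

    The two inner products are 2D ([dot1_rowsum_weight]) and 2W - 4D/n (from [dot2_center]). They
    are nonzero because the five claimed eigenvalues are distinct, which evaluating the
    indeterminates shows ([uniq_eig]). [orthogonal_idempotents] then converts idempotents and traces
    into spectrum and multiplicities. *)

Lemma fact_subn1 n : (0 < n)%N -> n`! = (n * (n - 1)`!)%N.
Proof. by case: n => // n _; rewrite subn1. Qed.

Lemma double_bin2 n : ('C(n, 2) * 2 = n * (n - 1))%N.
Proof. by rewrite bin_ffact ffactnS ffactn1 subn1. Qed.

(** * Spectra of combinations of orthogonal idempotents in characteristic 0 *)

Section SpectralResolution.

Variables (F : fieldType) (N : nat).
Hypothesis charF0 : forall k, (k%:R == 0 :> F) = (k == 0)%N.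

Lemma natr_inj_char0 : injective (fun k => k%:R : F).
Proof.
have wlog_le k l : (k <= l)%N -> k%:R = l%:R :> F -> k = l.
  move=> le_kl eq_kl; apply/eqP; rewrite eqn_leq le_kl -subn_eq0 -charF0.
  by rewrite natrB // eq_kl subrr eqxx.
move=> k l /= eq_kl; case/orP: (leq_total k l) => le_kl; first exact: wlog_le.
by apply/esym/(wlog_le _ _ le_kl).
Qed.

(** Multiplying the decomposition of 1 by [P i] shows that [P i] is idempotent, so [M] acts as [e i]
    on the row space of [P i], and these spaces span. Traces are known only in [F]; characteristic 0
    makes them determine natural numbers. *)
Lemma resolution_of_identity (I : finType) (P : I -> 'M[F]_N) (e : I -> F)
    (m : I -> nat) :
    injective e -> \sum_i P i = 1%:M ->
    (forall i j, i != j -> P i *m P j = 0) ->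
    (forall i, \tr (P i) = (m i)%:R) ->
  let M := \sum_i e i *: P i in
  [/\ diagonalizable M,
      forall a, eigenvalue M a -> exists i, a = e i
    & forall i, multiplicity M (e i) = m i].
Proof.
move=> e_inj P1 Port trP M.
have PM i : P i *m M = e i *: P i.
  rewrite /M mulmx_sumr (bigD1 i) //= big1 ?addr0.
    have PP : P i *m P i = P i.
      rewrite -[RHS]mulmx1 -P1 mulmx_sumr (bigD1 i) //= big1 ?addr0 // => j ji.
      by rewrite Port // eq_sym.
    by rewrite -scalemxAr PP.
  by move=> j ji; rewrite -scalemxAr Port ?scaler0 // eq_sym.
have dM : diagonalizable M.
  apply/diagonalizablePeigen; exists [seq e i | i <- enum I].
    by rewrite map_inj_uniq ?enum_uniq.
  rewrite big_image /=; apply/eqmxP; rewrite submx1 /= -P1.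
  apply: summx_sub => i _; apply: (sumsmx_sup i) => //.
  by apply/eigenspaceP; rewrite PM.
have [Q Qu /diagonalizable_forPex[d /(simmxP Qu) QM]] := dM.
have cM : char_poly M = \prod_k ('X - (d 0 k)%:P).
  have -> : M = invmx Q *m diag_mx d *m Q by rewrite -mulmxA -QM mulKmx.
  have -> : char_poly (invmx Q *m diag_mx d *m Q) = char_poly (diag_mx d).
    have QuP : map_mx (@polyC F) Q \in unitmx by rewrite map_unitmx.
    rewrite /char_poly.
    have -> : char_poly_mx (invmx Q *m diag_mx d *m Q)
       = invmx (map_mx (@polyC F) Q) *m char_poly_mx (diag_mx d)
          *m map_mx (@polyC F) Q.
      rewrite /char_poly_mx mulmxBr mulmxBl !map_mxM map_invmx.
      by rewrite mul_mx_scalar -scalemxAl mulVmx // scale_scalar_mx mulr1.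
    rewrite !det_mulmx mulrAC -det_mulmx mulVmx // det1 mul1r //.
  rewrite char_poly_trig ?diag_mx_is_trig //.
  by apply: eq_bigr => k _; rewrite mxE eqxx mulr1n.
(* In the diagonalizing basis the diagonal entries of P i are 0 or 1, so that *)
(* the trace of P i counts the eigenvalues equal to e i.                      *)
pose C i := Q *m P i *m invmx Q.
have Cd i : C i *m diag_mx d = e i *: C i.
  have QV : invmx Q *m diag_mx d = M *m invmx Q.
    by rewrite -[M in RHS](mulKmx Qu) QM -!mulmxA mulmxV // mulmx1.
  by rewrite /C -mulmxA QV -!mulmxA (mulmxA (P i)) PM -scalemxAl -scalemxAr.
have C0 i k : d 0 k != e i -> C i k k = 0.
  move=> dk; have /matrixP/(_ k k) := Cd i.
  rewrite mul_mx_diag !mxE => /eqP; rewrite mulrC -subr_eq0 -mulrBl mulf_eq0.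
  by rewrite subr_eq0 (negPf dk) => /eqP.
have C1 k : \sum_i C i k k = 1.
  transitivity ((\sum_i C i) k k); first by rewrite summxE.
  by rewrite -mulmx_suml -mulmx_sumr P1 mulmx1 mulmxV // mxE eqxx.
have dE k : exists i, d 0 k = e i.
  suff /existsP[i /eqP dk] : [exists i, d 0 k == e i] by exists i.
  apply: contraT => /existsPn dN; move: (C1 k).
  by rewrite big1 => [/eqP|i _]; [rewrite eq_sym oner_eq0 | rewrite C0 ?dN].
have Cdiag i k : C i k k = (d 0 k == e i)%:R.
  case: eqP => [dk|/eqP/C0-> //]; rewrite -[RHS](C1 k) (bigD1 i) //= big1 ?addr0//.
  move=> j ji; apply: C0; rewrite dk; apply: contra ji => /eqP/e_inj-> //.
split=> // [a|i].
  rewrite eigenvalue_root_char cM ; rewrite -(big_map _ predT (fun x => 'X - x%:P)).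
  by rewrite root_prod_XsubC => /mapP[k _ ->].
apply: natr_inj_char0; rewrite -trP /multiplicity cM.
rewrite -(big_map _ predT (fun x => 'X - x%:P)) mu_prod_XsubC.
have -> : \tr (P i) = \tr (C i) by rewrite /C mxtrace_mulC mulKmx.
rewrite count_map -sum1_count natr_sum big_mkcond /= /mxtrace.
by apply: eq_bigr => k _; rewrite Cdiag; case: eqP.
Qed.

(** The complement of the sum of the [P i] is one more orthogonal idempotent, with eigenvalue 0 and
    the remaining trace; it takes the index [None]. *)
Lemma orthogonal_idempotents (J : finType) (P : J -> 'M[F]_N) (e : J -> F)
    (m : J -> nat) :
    injective e -> (forall i, e i != 0) ->
    (forall i j, P i *m P j = if i == j then P i else 0) ->
    (forall i, \tr (P i) = (m i)%:R) -> (\sum_i m i <= N)%N ->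
  let M := \sum_i e i *: P i in
  [/\ diagonalizable M,
      forall a, eigenvalue M a -> a = 0 \/ exists i, a = e i,
      forall i, multiplicity M (e i) = m i
    & multiplicity M 0 = (N - \sum_i m i)%N].
Proof.
move=> e_inj e_n0 PP trP le_m M.
pose P' i := oapp P (1%:M - \sum_i P i) i.
pose m' i := oapp m (N - \sum_i m i)%N i.
have big_opt (V : zmodType) (f : option J -> V) :
    \sum_i f i = f None + \sum_i f (Some i).
  rewrite (bigD1 None) //=; congr (_ + _).
  rewrite (reindex_omap (@Some J) id) /=; last by case.
  by apply: eq_bigl => i; rewrite eqxx.
have P0l i : (\sum_j P j) *m P i = P i.
  rewrite mulmx_suml (bigD1 i) //= big1 ?addr0 ?PP ?eqxx // => j ji.
  by rewrite PP (negPf ji).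
have P0r i : P i *m (\sum_j P j) = P i.
  rewrite mulmx_sumr (bigD1 i) //= big1 ?addr0 ?PP ?eqxx // => j ji.
  by rewrite PP eq_sym (negPf ji).
have ME : M = \sum_i oapp e 0 i *: P' i by rewrite big_opt scale0r add0r.
have [] := @resolution_of_identity _ P' (oapp e 0) m'.
- case=> [i|] [j|] //= /eqP; last by rewrite eq_sym (negPf (e_n0 _)).
  + by move/eqP/e_inj->.
  + by rewrite (negPf (e_n0 _)).
- by rewrite big_opt /= subrK.
- case=> [i|] [j|] //= ij.
  + by rewrite PP (_ : (i == j) = false) //; apply: contraNF ij => /eqP->.
  + by rewrite mulmxBr mulmx1 P0r subrr.
  + by rewrite mulmxBl mul1mx P0l subrr.
- case=> //=; rewrite natrB // natr_sum -(eq_bigr _ (fun i _ => trP i)).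
  by rewrite -[\sum_i \tr _](raddf_sum mxtrace) -(mxtrace1 F) -raddfB.
rewrite -ME => dM eM mM; split=> // [a|i|].
- by move/eM=> [[i|] -> /=]; [right; exists i | left].
- exact: (mM (Some i)).
- exact: (mM None).
Qed.

End SpectralResolution.

(** * Kernels on the symmetric group and their products, computed from moments *)

Section PermutationKernels.
Variable F : fieldType.

Definition kernel_mx (I J : finType) (f : I -> J -> F) : 'M[F]_(#|I|, #|J|) :=
  \matrix_(i, j) f (enum_val i) (enum_val j).

Lemma big_enum_val_type (I : finType) (f : I -> F) :
  \sum_(k < #|I|) f (enum_val k) = \sum_i f i.
Proof. by rewrite [RHS](reindex _ (onW_bij _ (@enum_val_bij I))). Qed.

Lemma eq_kernel_mx (I J : finType) (f g : I -> J -> F) :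
  f =2 g -> kernel_mx f = kernel_mx g.
Proof. by move=> fg; apply/matrixP=> i j; rewrite !mxE. Qed.

Lemma mul_kernel_mx (I J K : finType) (f : I -> J -> F) (g : J -> K -> F) :
  kernel_mx f *m kernel_mx g = kernel_mx (fun i k => \sum_j f i j * g j k).
Proof.
apply/matrixP=> i k; rewrite !mxE -[RHS]big_enum_val_type.
by apply: eq_bigr => j _; rewrite !mxE.
Qed.

Lemma kernel_mxZ (I J : finType) a (f : I -> J -> F) :
  a *: kernel_mx f = kernel_mx (fun i j => a * f i j).
Proof. by apply/matrixP=> i j; rewrite !mxE. Qed.

Lemma kernel_mxD (I J : finType) (f g : I -> J -> F) :
  kernel_mx f + kernel_mx g = kernel_mx (fun i j => f i j + g i j).
Proof. by apply/matrixP=> i j; rewrite !mxE. Qed.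

Lemma trace_kernel_mx (I : finType) (f : I -> I -> F) :
  \tr (kernel_mx f) = \sum_i f i i.
Proof. by rewrite -[RHS]big_enum_val_type; apply: eq_bigr => i _; rewrite mxE. Qed.

Lemma kernel_mx0 (I J : finType) (f : I -> J -> F) :
  (forall i j, f i j = 0) -> kernel_mx f = 0.
Proof. by move=> f0; apply/matrixP=> i j; rewrite !mxE. Qed.

Variable n : nat.
Hypothesis charF0 : forall k, (k%:R == 0 :> F) = (k == 0)%N.
Hypothesis n_ge3 : (2 < n)%N.

Implicit Types (u v : 'I_n -> F) (w : 'I_n -> 'I_n -> F) (s t r : 'S_n).

Definition dot1 u v := \sum_a u a * v a.
Definition dot2 w w' := \sum_a \sum_b w a b * w' a b.
Definition sumless u := \sum_a u a = 0.
Definition antisym w := forall a b, w a b = - w b a.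
(** These are the divergence-free flows on the complete graph, a model of the exterior square of the
    sumless functions. *)
Definition pure w := antisym w /\ forall a, sumless (w a).

Definition act1 u s a := u (s a).
Definition act2 w s a b := w (s a) (s b).

Definition K1 u v := kernel_mx (fun s t => dot1 (act1 u s) (act1 v t)).
Definition K2 w w' := kernel_mx (fun s t => dot2 (act2 w s) (act2 w' t)).
Definition K0 := kernel_mx (fun s t => 1).

Let two_neq0 : 2%:R != 0 :> F. Proof. by rewrite charF0. Qed.

Lemma addrr_eq0 (x : F) : x = - x -> x = 0.
Proof.
move/eqP; rewrite -subr_eq0 opprK -mulr2n -mulr_natr mulf_eq0 (negPf two_neq0).
by rewrite orbF => /eqP.
Qed.

Lemma antisym_diag w a : antisym w -> w a a = 0.
Proof. by move=> wA; apply: addrr_eq0; rewrite {1}wA. Qed.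

Lemma pure_suml w b : pure w -> \sum_a w a b = 0.
Proof.
move=> [wA w0]; apply: oppr_inj; rewrite oppr0 -[RHS](w0 b) -sumrN.
by apply: eq_bigr => a _; rewrite wA opprK.
Qed.

Lemma sum_translate (f : 'S_n -> F) p :
  \sum_t f t = \sum_t f (p * t)%g.
Proof. exact: (reindex_inj (mulgI p)). Qed.

Lemma sum_perm (f : 'I_n -> F) s : \sum_a f (s a) = \sum_a f a.
Proof. by rewrite [RHS](reindex_inj (@perm_inj _ s)). Qed.

(** The recurring way to find a moment: the total over [b] vanishes by sumlessness or is otherwise
    known, and transpositions fixing [a] make all other terms equal, which determines their common
    value. *)
Lemma sum_const_off (f : 'I_n -> F) a x :
  (forall b, b != a -> f b = x) -> \sum_b f b = f a + (n - 1)%:R * x.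
Proof.
move=> fx; rewrite (bigD1 a) //=; congr (_ + _).
rewrite (eq_bigr (fun _ => x)) // sumr_const.
have := cardC1 a; rewrite card_ord => ->.
by rewrite subn1 mulr_natl.
Qed.

Lemma moment1 u a : sumless u -> \sum_(t : 'S_n) u (t a) = 0.
Proof.
move=> u0; have nn0 : n%:R != 0 :> F by rewrite charF0; lia.
apply: (mulfI nn0); rewrite mulr0.
have E b : \sum_(t : 'S_n) u (t b) = \sum_(t : 'S_n) u (t a).
  rewrite (sum_translate _ (tperm a b)).
  by apply: eq_bigr => t _; rewrite permM tpermR.
rewrite mulr_natl -[X in _ *+ X]card_ord -sumr_const.
rewrite -(eq_bigr _ (fun b _ => E b)) exchange_big /=.
by rewrite big1 // => t _; rewrite sum_perm u0.
Qed.

(** Translation makes the sum independent of [a]; summed over all [a], each [t] contributes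
    [dot1 u v]. *)
Lemma moment1_diag u v a :
  \sum_(t : 'S_n) u (t a) * v (t a) = (n - 1)`!%:R * dot1 u v.
Proof.
have nn0 : n%:R != 0 :> F by rewrite charF0; lia.
apply: (mulfI nn0).
have E b : \sum_(t : 'S_n) u (t b) * v (t b) = \sum_(t : 'S_n) u (t a) * v (t a).
  rewrite (sum_translate _ (tperm a b)).
  by apply: eq_bigr => t _; rewrite permM tpermR.
have <- : \sum_b \sum_(t : 'S_n) u (t b) * v (t b)
    = n%:R * \sum_(t : 'S_n) u (t a) * v (t a).
  by rewrite (eq_bigr _ (fun b _ => E b)) sumr_const card_ord mulr_natl.
rewrite exchange_big /=.
rewrite (eq_bigr (fun=> dot1 u v)) => [|t _]; last first.
  exact: (sum_perm (fun a => u a * v a)).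
by rewrite sumr_const card_Sn mulrA -natrM -fact_subn1 ?mulr_natl; last lia.
Qed.

Lemma moment1_off u v a b : sumless v -> a != b ->
  \sum_(t : 'S_n) u (t a) * v (t b) = - (n - 2)`!%:R * dot1 u v.
Proof.
move=> v0 ab.
have n10 : (n - 1)%:R != 0 :> F by rewrite charF0; lia.
apply: (mulfI n10).
have E c : c != a ->
    \sum_(t : 'S_n) u (t a) * v (t c) = \sum_(t : 'S_n) u (t a) * v (t b).
  move=> ca; rewrite (sum_translate _ (tperm b c)).
  by apply: eq_bigr => t _; rewrite !permM tpermR tpermD // eq_sym.
have := sum_const_off E; rewrite exchange_big /= big1 => [|t _]; last first.
  by rewrite -mulr_sumr sum_perm v0 mulr0.
rewrite moment1_diag => /esym/eqP; rewrite addrC addr_eq0 => /eqP->.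
rewrite mulNr mulrN mulrA -natrM; congr (- (_%:R * _)).
by rewrite fact_subn1 -?subnDA; last lia.
Qed.

(** By the two moments, summing over the middle permutation gives [dot1 v u'] times the matrix
    ((n-1)! + (n-2)!) Id - (n-2)! Ones. Ones vanishes on sumless functions, and (n-1)! + (n-2)! = n
    (n-2)!. *)
Lemma K1_mul u v u' v' : sumless u -> sumless v -> sumless u' -> sumless v' ->
  K1 u v *m K1 u' v' = (n%:R * (n - 2)`!%:R * dot1 v u') *: K1 u v'.
Proof.
move=> u0 v0 u'0 v'0; rewrite mul_kernel_mx kernel_mxZ.
apply: eq_kernel_mx => s r; rewrite /dot1 /act1.
transitivity (\sum_a \sum_b u (s a) * v' (r b) * \sum_(t : 'S_n) v (t a) * u' (t b)).
  transitivity (\sum_(t : 'S_n) \sum_a \sum_b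
      u (s a) * v' (r b) * (v (t a) * u' (t b))).
    apply: eq_bigr => t _; rewrite mulr_suml; apply: eq_bigr => a _.
    by rewrite mulr_sumr; apply: eq_bigr => b _; ring.
  rewrite exchange_big /=; apply: eq_bigr => a _.
  by rewrite exchange_big /=; apply: eq_bigr => b _; rewrite -mulr_sumr.
rewrite mulr_sumr; apply: eq_bigr => a _.
rewrite (bigD1 a) //=
  (eq_bigr (fun b => - (n - 2)`!%:R * dot1 v u' * u (s a) * v' (r b))); last first.
  by move=> b ba; rewrite moment1_off 1?eq_sym //; ring.
rewrite moment1_diag -mulr_sumr.
have -> : \sum_(i | i != a) v' (r i) = - v' (r a).
  apply/eqP; rewrite -addr_eq0 addrC; apply/eqP.
  by have := sum_perm v' r; rewrite v'0 (bigD1 a).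
have -> : (n - 1)`!%:R = (n%:R - 1) * (n - 2)`!%:R :> F.
  by rewrite fact_subn1 -?subnDA ?natrM ?natrB; [|lia..].
rewrite /dot1; ring.
Qed.

Lemma K0_K1 u v : sumless u -> K0 *m K1 u v = 0.
Proof.
move=> u0; rewrite mul_kernel_mx; apply: kernel_mx0 => s r.
under eq_bigr do rewrite mul1r.
rewrite exchange_big /= big1 // => a _.
by rewrite -mulr_suml moment1 // mul0r.
Qed.

Lemma K1_K0 u v : sumless v -> K1 u v *m K0 = 0.
Proof.
move=> v0; rewrite mul_kernel_mx; apply: kernel_mx0 => s r.
under eq_bigr do rewrite mulr1.
rewrite exchange_big /= big1 // => a _.
by rewrite -mulr_sumr moment1 // mulr0.
Qed.

Lemma K0_K0 : K0 *m K0 = n`!%:R *: K0.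
Proof.
rewrite mul_kernel_mx kernel_mxZ; apply: eq_kernel_mx => s r.
by rewrite !mulr1 sumr_const card_Sn.
Qed.

(** Transposing [a] and [b] changes the sign of the sum. *)
Lemma moment2 w a b : antisym w -> \sum_(t : 'S_n) w (t a) (t b) = 0.
Proof.
move=> wA; apply: addrr_eq0; rewrite -sumrN {1}(sum_translate _ (tperm a b)).
by apply: eq_bigr => t _; rewrite !permM tpermL tpermR.
Qed.

Lemma K0_K2 w w' : antisym w -> K0 *m K2 w w' = 0.
Proof.
move=> wA; rewrite mul_kernel_mx; apply: kernel_mx0 => s r.
under eq_bigr do rewrite mul1r.
rewrite exchange_big /= big1 // => a _; rewrite exchange_big /= big1 // => b _.
by rewrite -mulr_suml moment2 // mul0r.
Qed.

Lemma K2_K0 w w' : antisym w' -> K2 w w' *m K0 = 0.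
Proof.
move=> wA; rewrite mul_kernel_mx; apply: kernel_mx0 => s r.
under eq_bigr do rewrite mulr1.
rewrite exchange_big /= big1 // => a _; rewrite exchange_big /= big1 // => b _.
by rewrite -mulr_sumr moment2 // mulr0.
Qed.

(** The standard representation and its exterior square admit no invariant pairing. Concretely, if
    [a] is neither [b] nor [c], transposing [b] and [c] flips the sign; otherwise the zero row sums
    of [w] force the common value to vanish. *)
Lemma moment12 u w a b c : pure w ->
  \sum_(t : 'S_n) u (t a) * w (t b) (t c) = 0.
Proof.
move=> pw; have [wA w0] := pw.
have swap b' c' : \sum_(t : 'S_n) u (t a) * w (t b') (t c')
    = - \sum_(t : 'S_n) u (t a) * w (t c') (t b').
  by rewrite -sumrN; apply: eq_bigr => t _; rewrite wA mulrN.
have at_a d : \sum_(t : 'S_n) u (t a) * w (t a) (t d) = 0.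
  have [->|da] := eqVneq d a.
    by rewrite big1 // => t _; rewrite antisym_diag // mulr0.
  have E c' : c' != a -> \sum_(t : 'S_n) u (t a) * w (t a) (t c')
        = \sum_(t : 'S_n) u (t a) * w (t a) (t d).
    move=> ca; rewrite (sum_translate _ (tperm d c')).
    by apply: eq_bigr => t _; rewrite !permM tpermR tpermD // eq_sym.
  have := sum_const_off E; rewrite exchange_big /= big1 => [|t _]; last first.
    by rewrite -mulr_sumr sum_perm w0 mulr0.
  rewrite [X in X + _]big1 => [|t _]; last by rewrite antisym_diag // mulr0.
  rewrite add0r => /esym/eqP; rewrite mulf_eq0 charF0 => /orP[|/eqP//].
  by move=> n1; have : False by lia.
have [->//|ba] := eqVneq b a.
have [->|ca] := eqVneq c a; first by rewrite swap at_a oppr0.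
apply: addrr_eq0; rewrite -swap (sum_translate _ (tperm b c)).
by apply: eq_bigr => t _; rewrite !permM tpermL tpermR tpermD.
Qed.

Lemma K1_K2 u v w w' : pure w -> K1 u v *m K2 w w' = 0.
Proof.
move=> pw; rewrite mul_kernel_mx; apply: kernel_mx0 => s r.
transitivity (\sum_a \sum_b \sum_c \sum_(t : 'S_n)
   u (s a) * w' (r b) (r c) * (v (t a) * w (t b) (t c))).
  under eq_bigr do rewrite mulr_suml.
  rewrite exchange_big /=; apply: eq_bigr => a _.
  under eq_bigr do rewrite mulr_sumr.
  rewrite exchange_big /=; apply: eq_bigr => b _.
  under eq_bigr do rewrite mulr_sumr.
  rewrite exchange_big /=; apply: eq_bigr => c _.
  by apply: eq_bigr => t _; rewrite /act1 /act2; ring.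
rewrite big1 // => a _; rewrite big1 // => b _; rewrite big1 // => c _.
by rewrite -mulr_sumr moment12 // mulr0.
Qed.

Lemma K2_K1 u v w w' : pure w' -> K2 w w' *m K1 u v = 0.
Proof.
move=> pw; rewrite mul_kernel_mx; apply: kernel_mx0 => s r.
transitivity (\sum_a \sum_b \sum_c \sum_(t : 'S_n)
   v (r a) * w (s b) (s c) * (u (t a) * w' (t b) (t c))).
  under eq_bigr do rewrite mulr_sumr.
  rewrite exchange_big /=; apply: eq_bigr => a _.
  under eq_bigr do rewrite mulr_suml.
  rewrite exchange_big /=; apply: eq_bigr => b _.
  under eq_bigr do rewrite mulr_suml.
  rewrite exchange_big /=; apply: eq_bigr => c _.
  by apply: eq_bigr => t _; rewrite /act1 /act2; ring.
rewrite big1 // => a _; rewrite big1 // => b _; rewrite big1 // => c _.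
by rewrite -mulr_sumr moment12 // mulr0.
Qed.

Lemma sum_delta (f : 'I_n -> F) a : \sum_b (a == b)%:R * f b = f a.
Proof.
rewrite (bigD1 a) //= eqxx mul1r big1 ?addr0 // => b /negPf ba.
by rewrite eq_sym ba mul0r.
Qed.

(** * Second moments of two pure functions *)

Section PairMoments.

Variables w w' : 'I_n -> 'I_n -> F.
Hypotheses (pw : pure w) (pw' : pure w').

Definition cov a b c d := \sum_(t : 'S_n) w (t a) (t b) * w' (t c) (t d).

Let covNl a b c d : cov b a c d = - cov a b c d.
Proof.
by rewrite -sumrN; apply: eq_bigr => t _; rewrite (proj1 pw) mulNr.
Qed.

Let covNr a b c d : cov a b d c = - cov a b c d.
Proof.
by rewrite -sumrN; apply: eq_bigr => t _; rewrite (proj1 pw') mulrN.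
Qed.

Let cov_perm (p : 'S_n) a b c d : cov (p a) (p b) (p c) (p d) = cov a b c d.
Proof.
rewrite [RHS](sum_translate _ p); apply: eq_bigr => t _.
by rewrite !permM.
Qed.

Let covll a c d : cov a a c d = 0. Proof. exact/addrr_eq0/covNl. Qed.
Let covrr a b c : cov a b c c = 0. Proof. exact/addrr_eq0/covNr. Qed.

(** The group is 2-transitive, so all n (n-1) such values agree; their total is n! times
    [dot2 w w']. *)
Let cov_diag a b : a != b -> cov a b a b = (n - 2)`!%:R * dot2 w w'.
Proof.
move=> ab.
have E c d : d != c -> cov c d c d = cov a b a b.
  (* The first transposition sends [a] to [c]; the second sends the image of [b] to [d] and fixes
     [c]. *)
  move=> dc; pose p := (tperm a c * tperm (tperm a c b) d)%g.
  have pa : p a = c.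
    rewrite permM tpermL tpermD // -[X in _ != X](tpermL a c).
    by rewrite (inj_eq perm_inj) eq_sym.
  have pb : p b = d by rewrite permM tpermL.
  by rewrite -[RHS](cov_perm p) pa pb.
have S c : \sum_d cov c d c d = (n - 1)%:R * cov a b a b.
  by rewrite (sum_const_off (E c)) covll add0r.
have T : \sum_c \sum_d cov c d c d = n`!%:R * dot2 w w'.
  under eq_bigr do rewrite exchange_big.
  rewrite exchange_big /= (eq_bigr (fun=> dot2 w w')) => [|t _].
    by rewrite sumr_const card_Sn mulr_natl.
  rewrite /dot2 -[RHS](sum_perm _ t); apply: eq_bigr => c _.
  by rewrite -[RHS](sum_perm _ t).
have nn0 : n%:R * (n - 1)%:R != 0 :> F by rewrite -natrM charF0; lia.
apply: (mulfI nn0); transitivity (n`!%:R * dot2 w w').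
  rewrite -T (eq_bigr _ (fun c _ => S c)) sumr_const card_ord.
  by rewrite -[RHS]mulr_natl mulrA.
rewrite (@fact_subn1 n) 1?(@fact_subn1 (n - 1)); try lia.
by rewrite -subnDA !natrM; ring.
Qed.

Let cov_share a b d : a != b -> d != a -> d != b ->
  cov a b a d = - (n - 3)`!%:R * dot2 w w'.
Proof.
move=> ab da db.
(* The sum over c of cov a b a c vanishes; the indicator makes all the terms  *)
(* with c != b equal, including the zero term c = a.                          *)
have E c : c != b -> cov a b a c + (c == a)%:R * cov a b a d = cov a b a d.
  have [->|ca] := eqVneq c a; first by rewrite covrr add0r mul1r.
  move=> cb; rewrite mul0r addr0 -(cov_perm (tperm c d)) tpermL.
  by rewrite !tpermD // eq_sym.
have := sum_const_off E; rewrite big_split /=.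
rewrite (exchange_big) big1 => [|t _] /=; last first.
  by rewrite -mulr_sumr sum_perm (proj2 pw') mulr0.
under eq_bigr do rewrite eq_sym.
rewrite (sum_delta (fun=> cov a b a d)) add0r eq_sym (negPf ab) mul0r addr0.
rewrite cov_diag // => H.
have n20 : (n - 2)%:R != 0 :> F by rewrite charF0; lia.
apply: (mulfI n20); rewrite mulNr mulrN mulrA -natrM.
have -> : ((n - 2) * (n - 3)`! = (n - 2)`!)%N.
  by rewrite (@fact_subn1 (n - 2)) -?subnDA //; lia.
have n12 : (n - 1)%:R = (n - 2)%:R + 1 :> F.
  by rewrite natr1; congr _%:R; lia.
move: H; rewrite n12 => H; apply/eqP; rewrite -subr_eq0 opprK; apply/eqP.
by apply: (addrI (cov a b a d)); rewrite addr0 [RHS]H; ring.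
Qed.

Let cov_disj a b c d : c != a -> c != b -> d != a -> d != b -> cov a b c d = 0.
Proof.
move=> ca cb da db; apply: addrr_eq0; rewrite -covNl -(cov_perm (tperm a b)).
by rewrite tpermL tpermR !tpermD // eq_sym.
Qed.

(** Only the coincidences between the two pairs matter. The second factor is n - 2 for equal pairs,
    -1 for one shared entry in the same slot, 0 for disjoint pairs, and antisymmetry settles the
    rest: it is n times an antisymmetrizer, minus terms that see only row and column sums. *)
Lemma covE a b c d : cov a b c d = (n - 3)`!%:R * dot2 w w' *
  (n%:R * ((a == c)%:R * (b == d)%:R - (a == d)%:R * (b == c)%:R)
   - ((a == c)%:R - (a == d)%:R - (b == c)%:R + (b == d)%:R)).
Proof.
have neqE (x y : 'I_n) : x != y -> ((x == y) = false) * ((y == x) = false).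
  by move=> /negPf xy; rewrite [y == x]eq_sym.
have [<-|/neqE ab] := eqVneq a b; first by rewrite covll; ring.
have [<-|/neqE cd] := eqVneq c d; first by rewrite covrr; ring.
have n2 : (n - 2)`!%:R = (n%:R - 2) * (n - 3)`!%:R :> F.
  by rewrite (@fact_subn1 (n - 2)) -?subnDA ?natrM ?natrB //; lia.
have [ac|/neqE ac] := eqVneq a c.
  subst c; have [bd|/neqE bd] := eqVneq b d.
    by subst d; rewrite cov_diag ?(eqxx, ab) //= n2; ring.
  by rewrite cov_share ?(eqxx, ab, bd, cd) //=; ring.
have [ad|/neqE ad] := eqVneq a d.
  subst d; rewrite covNr; have [bc|/neqE bc] := eqVneq b c.
    by subst c; rewrite cov_diag ?(eqxx, ab) //= n2; ring.
  by rewrite cov_share ?(eqxx, ab, bc, cd) //=; ring.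
have [bc|/neqE bc] := eqVneq b c.
  subst c; rewrite covNl; have [bd|/neqE bd] := eqVneq b d.
    by rewrite bd eqxx in cd; case: cd.
  by rewrite cov_share ?(eqxx, ab, ad, bd) //=; ring.
have [bd|/neqE bd] := eqVneq b d.
  by subst d; rewrite covNl covNr cov_share ?(eqxx, ab, ac, bc) //=; ring.
by rewrite cov_disj ?(eqxx, ac, bc, ad, bd) //=; ring.
Qed.

(** On a pure [q] the row and column sum terms of [covE] vanish, and the antisymmetrizer doubles
    [q a b]. *)
Lemma cov_contract q a b : pure q ->
  \sum_c \sum_d cov a b c d * q c d
    = 2 * n%:R * (n - 3)`!%:R * dot2 w w' * q a b.
Proof.
move=> pq; have [qA q0] := pq.
pose g := (n - 3)`!%:R * dot2 w w'.
transitivity (g * (n%:R * (q a b - q b a)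
   - (\sum_d q a d - \sum_c q c a - \sum_d q b d + \sum_c q c b))).
  (* Entries and row or column sums are all written as double sums with indicators, so that the
     identity can be checked term by term. *)
  have D1 x y : q x y = \sum_c \sum_d (x == c)%:R * ((y == d)%:R * q c d).
    rewrite -(sum_delta (q^~ y)); apply: eq_bigr => c _.
    by rewrite -mulr_sumr sum_delta.
  have D2 x : \sum_d q x d = \sum_c \sum_d (x == c)%:R * q c d.
    by under [RHS]eq_bigr do rewrite -mulr_sumr; rewrite sum_delta.
  have D3 x : \sum_c q c x = \sum_c \sum_d (x == d)%:R * q c d.
    by apply: eq_bigr => c _; rewrite sum_delta.
  rewrite (D1 a b) (D1 b a) !D2 !D3.
  rewrite -!(big_split, sumrB) /= mulr_sumr -sumrB mulr_sumr.
  apply: eq_bigr => c _.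
  rewrite -!(big_split, sumrB) /= mulr_sumr -sumrB mulr_sumr.
  by apply: eq_bigr => d _; rewrite covE /g; ring.
by rewrite !q0 !pure_suml // qA /g; ring.
Qed.

End PairMoments.

Lemma K2_mul w1 w w' w2 : pure w -> pure w' -> pure w2 ->
  K2 w1 w *m K2 w' w2 = (2 * n%:R * (n - 3)`!%:R * dot2 w w') *: K2 w1 w2.
Proof.
move=> pw pw' pw2; rewrite mul_kernel_mx kernel_mxZ.
apply: eq_kernel_mx => s r.
transitivity (\sum_a \sum_b w1 (s a) (s b) *
    \sum_c \sum_d cov w w' a b c d * w2 (r c) (r d)).
  under eq_bigr do rewrite mulr_suml.
  rewrite exchange_big /=; apply: eq_bigr => a _.
  under eq_bigr do rewrite mulr_suml.
  rewrite exchange_big /=; apply: eq_bigr => b _.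
  under eq_bigr do rewrite mulr_sumr.
  rewrite exchange_big mulr_sumr; apply: eq_bigr => c _ /=.
  under eq_bigr do rewrite mulr_sumr.
  rewrite exchange_big mulr_sumr; apply: eq_bigr => d _ /=.
  rewrite mulr_suml mulr_sumr; apply: eq_bigr => t _.
  by rewrite /act2; ring.
rewrite mulr_sumr; apply: eq_bigr => a _.
rewrite mulr_sumr; apply: eq_bigr => b _.
rewrite (@cov_contract _ _ pw pw' (act2 w2 r)) ?/act2; first ring.
have [w2A w20] := pw2; split=> [c d|c]; first exact: w2A.
by rewrite /sumless -[RHS](w20 (r c)) -[RHS](sum_perm _ r).
Qed.

End PermutationKernels.

(** * Splitting into gradient and divergence-free parts; the fixed-point kernel *)

Section CenteredKernels.
Variable F : fieldType.
Variable n : nat.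
Hypothesis charF0 : forall k, (k%:R == 0 :> F) = (k == 0)%N.
Hypothesis n_ge3 : (2 < n)%N.

Implicit Types (u v : 'I_n -> F) (w : 'I_n -> 'I_n -> F) (s t r : 'S_n).
Local Notation K0 := (K0 F n).

Let two_neq0 : 2%:R != 0 :> F. Proof. by rewrite charF0. Qed.
Let n_neq0 : n%:R != 0 :> F. Proof. by rewrite charF0; lia. Qed.

Let natr_n1 : (n - 1)%:R = n%:R - 1 :> F. Proof. by rewrite natrB //; lia. Qed.
Let natr_n2 : (n - 2)%:R = n%:R - 2 :> F. Proof. by rewrite natrB //; lia. Qed.
Let factn0 : n`!%:R = n%:R * (n - 1)`!%:R :> F.
Proof. by rewrite (@fact_subn1 n) ?natrM //; lia. Qed.
Let factn1 : (n - 1)`!%:R = (n%:R - 1) * (n - 2)`!%:R :> F.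
Proof. by rewrite (@fact_subn1 (n - 1)) -?subnDA ?natrM ?natr_n1 //; lia. Qed.
Let factn2 : (n - 2)`!%:R = (n%:R - 2) * (n - 3)`!%:R :> F.
Proof. by rewrite (@fact_subn1 (n - 2)) -?subnDA ?natrM ?natr_n2 //; lia. Qed.

Definition grad u a b := u a - u b.
Definition rowsum w a := \sum_b w a b.
(** The gradient of a sumless [h] has row sums n h, whence the factor 1/n: this is the Hodge
    decomposition on the complete graph. *)
Definition center w a b := w a b - n%:R^-1 * grad (rowsum w) a b.

Lemma sumless_rowsum w : antisym w -> sumless (rowsum w).
Proof.
move=> wA; apply: (addrr_eq0 charF0); rewrite -sumrN /rowsum exchange_big.
by apply: eq_bigr => a _; rewrite -sumrN; apply: eq_bigr => b _; apply: wA.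
Qed.

Lemma pure_center w : antisym w -> pure (center w).
Proof.
move=> wA; split=> [a b|a]; first by rewrite /center /grad wA; ring.
rewrite /sumless sumrB -mulr_sumr sumrB sumr_const card_ord.
by rewrite (sumless_rowsum wA) subr0 -[rowsum w a *+ n]mulr_natl mulKf ?subrr.
Qed.

Lemma dot2C w w' : dot2 w w' = dot2 w' w.
Proof. by do 2![apply: eq_bigr => ? _]; rewrite mulrC. Qed.

(** Summation by parts moves the gradient onto the row and column sums of [w]. *)
Lemma dot2_pure_grad w u : pure w -> dot2 w (grad u) = 0.
Proof.
move=> pw; have [wA w0] := pw.
transitivity (\sum_a u a * (\sum_b w a b) - \sum_b u b * (\sum_a w a b)).
  under [X in _ = _ - X]eq_bigr do rewrite mulr_sumr.
  rewrite [X in _ = _ - X]exchange_big -sumrB; apply: eq_bigr => a _.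
  by rewrite mulr_sumr -sumrB; apply: eq_bigr => b _; rewrite /grad; ring.
rewrite !big1 ?subrr // => a _; first by rewrite pure_suml ?mulr0.
by rewrite w0 mulr0.
Qed.

Lemma dot2_grad u v : sumless u -> dot2 (grad u) (grad v) = 2 * n%:R * dot1 u v.
Proof.
move=> u0.
transitivity (\sum_a (n%:R * (u a * v a) - u a * (\sum_b v b)
   - v a * (\sum_b u b) + dot1 u v)).
  apply: eq_bigr => a _; rewrite !mulr_sumr mulr_natl.
  rewrite -[X in _ *+ X]card_ord -sumr_const /dot1 -!sumrB -big_split.
  by apply: eq_bigr => b _; rewrite /grad /=; ring.
rewrite big_split /= !sumrB -mulr_sumr -!mulr_suml u0 sumr_const card_ord.
by rewrite -[dot1 u v *+ n]mulr_natl /dot1; ring.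
Qed.

(** Pure parts are orthogonal to gradients; the gradients contribute 2n/n^2 times the pairing of the
    row sums. *)
Lemma dot2_center w w' : antisym w -> antisym w' ->
  dot2 w w' = dot2 (center w) (center w')
    + 2 / n%:R * dot1 (rowsum w) (rowsum w').
Proof.
move=> wA wA'; pose i : F := n%:R^-1.
transitivity (dot2 (center w) (center w') + i * dot2 (center w) (grad (rowsum w'))
  + i * dot2 (center w') (grad (rowsum w))
  + i * i * dot2 (grad (rowsum w)) (grad (rowsum w'))).
  rewrite /dot2 !mulr_sumr -!big_split; apply: eq_bigr => a _.
  rewrite !mulr_sumr -!big_split; apply: eq_bigr => b _.
  by rewrite /center -/i /=; ring.
rewrite (dot2_pure_grad _ (pure_center wA)) (dot2_pure_grad _ (pure_center wA')).
by rewrite (dot2_grad _ (sumless_rowsum wA)) /i; field.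
Qed.

Lemma antisym_act2 w s : antisym w -> antisym (act2 w s).
Proof. by move=> wA a b; apply: wA. Qed.

Lemma rowsum_act2 w s a : rowsum (act2 w s) a = rowsum w (s a).
Proof. exact: (sum_perm (w (s a)) s). Qed.

Lemma K2_center w w' : antisym w -> antisym w' ->
  K2 w w' = K2 (center w) (center w')
    + (2 / n%:R) *: K1 (rowsum w) (rowsum w').
Proof.
move=> wA wA'; rewrite kernel_mxZ kernel_mxD; apply: eq_kernel_mx => s t.
rewrite dot2_center; try exact: antisym_act2.
congr (_ + _ * _).
  do 2![apply: eq_bigr => ? _].
  by rewrite /center /grad !rowsum_act2.
by apply: eq_bigr => a _; rewrite !rowsum_act2.
Qed.

(** The projection of the basis vector at [k] onto the sumless functions. *)
Definition cdelta (k : 'I_n) a : F := (k == a)%:R - n%:R^-1.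
(** Subtracting 1 removes the trivial component of the permutation representation. *)
Definition Kfix := kernel_mx (fun s t => \sum_a (s a == t a)%:R - 1 : F).

Lemma sumless_cdelta k : sumless (cdelta k).
Proof.
rewrite /sumless sumrB sumr_const card_ord -[n%:R^-1 *+ n]mulr_natl mulfV //.
rewrite (eq_bigr (fun a => (k == a)%:R * 1)) => [|a _]; last by rewrite mulr1.
by rewrite (sum_delta (fun=> 1)) subrr.
Qed.

Lemma dot1_cdelta k u : sumless u -> dot1 (cdelta k) u = u k.
Proof.
move=> u0; rewrite /dot1; under eq_bigr do rewrite mulrBl.
by rewrite sumrB sum_delta -mulr_sumr u0 mulr0 subr0.
Qed.

Lemma sum_cdelta u a : sumless u -> \sum_k u k * cdelta k a = u a.
Proof.
move=> u0; rewrite -[RHS](dot1_cdelta a u0); apply: eq_bigr => k _.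
by rewrite mulrC /cdelta eq_sym.
Qed.

(** Spreading the subtracted 1 over the n values of [a] turns each term into [cdelta (s a)] at
    [t a], which the reproducing property [sum_cdelta] expands over [k]. *)
Lemma KfixE : Kfix = \sum_k K1 (cdelta k) (cdelta k).
Proof.
apply/matrixP => i j; rewrite summxE mxE.
under [RHS]eq_bigr do rewrite mxE.
rewrite [RHS]exchange_big /=.
set s := enum_val i; set t := enum_val j.
transitivity (\sum_a ((s a == t a)%:R - n%:R^-1 : F)).
  by rewrite sumrB sumr_const card_ord -[n%:R^-1 *+ n]mulr_natl mulfV.
apply: eq_bigr => a _; rewrite -[LHS](sum_cdelta _ (sumless_cdelta (s a))).
apply: eq_bigr => k _.
by rewrite /act1 {1}/cdelta eq_sym.
Qed.

Lemma tr_K1 u v : (K1 u v)^T = K1 v u.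
Proof.
by apply/matrixP => i j; rewrite !mxE; apply: eq_bigr => a _; rewrite mulrC.
Qed.

Lemma tr_Kfix : Kfix^T = Kfix.
Proof. by rewrite KfixE raddf_sum; apply: eq_bigr => k _; apply: tr_K1. Qed.

(** The summand at [k] yields [u k] times the kernel of [cdelta k] and [v]; the reproducing property
    reassembles [u]. *)
Lemma Kfix_K1 u v : sumless u -> sumless v ->
  Kfix *m K1 u v = (n%:R * (n - 2)`!%:R) *: K1 u v.
Proof.
move=> u0 v0; rewrite KfixE mulmx_suml.
have dl0 := sumless_cdelta.
under eq_bigr do rewrite (K1_mul charF0 n_ge3) // dot1_cdelta // -scalerA.
rewrite -scaler_sumr; congr (_ *: _); apply/matrixP => i j; rewrite summxE !mxE.
under eq_bigr do rewrite !mxE mulr_sumr.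
rewrite exchange_big /=; apply: eq_bigr => a _.
under eq_bigr do rewrite mulrA.
by rewrite -mulr_suml /act1 sum_cdelta.
Qed.

Lemma K1_Kfix u v : sumless u -> sumless v ->
  K1 u v *m Kfix = (n%:R * (n - 2)`!%:R) *: K1 u v.
Proof.
move=> u0 v0; apply: trmx_inj.
by rewrite trmx_mul tr_Kfix linearZ /= !tr_K1 Kfix_K1.
Qed.

Lemma Kfix_Kfix : Kfix *m Kfix = (n%:R * (n - 2)`!%:R) *: Kfix.
Proof.
rewrite {2 3}KfixE mulmx_sumr scaler_sumr; apply: eq_bigr => k _.
by apply: Kfix_K1; apply: sumless_cdelta.
Qed.

Lemma Kfix_K0 : Kfix *m K0 = 0.
Proof.
rewrite KfixE mulmx_suml big1 // => k _.
by rewrite (K1_K0 charF0 n_ge3) //; apply: sumless_cdelta.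
Qed.

Lemma K0_Kfix : K0 *m Kfix = 0.
Proof.
rewrite KfixE mulmx_sumr big1 // => k _.
by rewrite (K0_K1 charF0 n_ge3) //; apply: sumless_cdelta.
Qed.

Lemma Kfix_K2 w w' : pure w -> Kfix *m K2 w w' = 0.
Proof.
by move=> pw; rewrite KfixE mulmx_suml big1 // => k _; rewrite (K1_K2 charF0).
Qed.

Lemma K2_Kfix w w' : pure w' -> K2 w w' *m Kfix = 0.
Proof.
by move=> pw; rewrite KfixE mulmx_sumr big1 // => k _; rewrite (K2_K1 charF0).
Qed.

Lemma trace_K0 : \tr K0 = n`!%:R.
Proof. by rewrite trace_kernel_mx sumr_const card_Sn. Qed.

Lemma trace_K1 u v : \tr (K1 u v) = n`!%:R * dot1 u v.
Proof.
rewrite trace_kernel_mx (eq_bigr (fun=> dot1 u v)).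
  by rewrite sumr_const card_Sn mulr_natl.
by move=> t _; apply: (sum_perm (fun a => u a * v a) t).
Qed.

Lemma trace_K2 w w' : \tr (K2 w w') = n`!%:R * dot2 w w'.
Proof.
rewrite trace_kernel_mx (eq_bigr (fun=> dot2 w w')).
  by rewrite sumr_const card_Sn mulr_natl.
move=> t _; rewrite /dot2 -[RHS](sum_perm _ t); apply: eq_bigr => a _.
by rewrite -[RHS](sum_perm _ t).
Qed.

Lemma trace_Kfix : \tr Kfix = n`!%:R * (n%:R - 1).
Proof.
rewrite trace_kernel_mx (eq_bigr (fun=> n%:R - 1)).
  by rewrite sumr_const card_Sn mulr_natl.
move=> t _; congr (_ - _); under eq_bigr do rewrite eqxx.
by rewrite sumr_const card_ord.
Qed.

Lemma kernel_spectrum w w' (alpha z : F) :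
    antisym w -> antisym w' ->
  let M := alpha *: K0 + z *: Kfix - 4%:R^-1 *: K2 w w' in
  let g1 := dot1 (rowsum w) (rowsum w') in
  let g2 := dot2 (center w) (center w') in
  let e4 := n%:R * (n - 2)`!%:R * z in
  let e1 := n`!%:R * alpha in
  let e2 := e4 - (n - 2)`!%:R / 2 * g1 in
  let e3 := - (n%:R / 2 * (n - 3)`!%:R * g2) in
  uniq [:: e1; e2; e3; e4; 0] ->
  let m := (1 + (n - 1) + 'C(n - 1, 2) + (n - 1) * (n - 2))%N in
  (m < n`!)%N ->
  [/\ diagonalizable M,
      (forall a, eigenvalue M a <-> a \in [:: e1; e2; e3; e4; 0])
    & [/\ multiplicity M e1 = 1%N,
          multiplicity M e2 = (n - 1)%N,
          multiplicity M e3 = 'C(n - 1, 2),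
          multiplicity M e4 = ((n - 1) * (n - 2))%N
        & multiplicity M 0 = (n`! - m)%N]].
Proof.
move=> wA wA' M g1 g2 e4 e1 e2 e3 ue m lt_m.
have [n1_gt0 n1C2_gt0 prod_gt0] :
    [/\ 0 < n - 1, 0 < 'C(n - 1, 2) & 0 < (n - 1) * (n - 2)]%N.
  by split; rewrite ?bin_gt0 ?muln_gt0; lia.
have u0 := sumless_rowsum wA; have u0' := sumless_rowsum wA'.
have pw := pure_center wA; have pw' := pure_center wA'.
have fne0 k : k`!%:R != 0 :> F by rewrite charF0 -lt0n fact_gt0.
(* If [g1] vanished, [e2] would equal [e4]; if [g2] vanished, [e3] would be 0. Both contradict
   distinctness. *)
have g1n0 : g1 != 0.
  apply: contraTneq ue => g10.
  by rewrite /= !inE /e2 g10 mulr0 subr0 eqxx !orbT !andbF.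
have g2n0 : g2 != 0.
  apply: contraTneq ue => g20.
  by rewrite /= !inE /e3 g20 mulr0 oppr0 eqxx !orbT !andbF.
have q_h : dot1 (rowsum w') (rowsum w) = g1 by apply: eq_bigr => a _; rewrite mulrC.
have p_p : dot2 (center w') (center w) = g2 by rewrite dot2C.
pose P1 := n`!%:R^-1 *: K0.
pose P2 := (n%:R * (n - 2)`!%:R * g1)^-1 *: K1 (rowsum w) (rowsum w').
pose P3 := (2 * n%:R * (n - 3)`!%:R * g2)^-1 *: K2 (center w) (center w').
pose Q := (n%:R * (n - 2)`!%:R)^-1 *: Kfix.
(* [Q] is the projection onto the whole standard isotypic component. On its part outside [P2] only
   the fixed-point kernel acts. *)
pose P4 := Q - P2.
have kn0 : n%:R * (n - 2)`!%:R != 0 :> F by rewrite mulf_neq0.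
have k1n0 : n%:R * (n - 2)`!%:R * g1 != 0 by rewrite mulf_neq0.
have k2n0 : 2 * n%:R * (n - 3)`!%:R * g2 != 0 by rewrite !mulf_neq0.
have ME : M = e1 *: P1 + e2 *: P2 + e3 *: P3 + e4 *: P4.
  have -> : e2 *: P2 = e4 *: P2 - ((n - 2)`!%:R / 2 * g1) *: P2 by rewrite scalerBl.
  rewrite /P4 scalerBr /M (K2_center wA wA') scalerDr scalerA.
  rewrite /P1 /P2 /P3 /Q !scalerA.
  have -> : e1 / n`!%:R = alpha by rewrite /e1; field.
  have -> : e4 / (n%:R * (n - 2)`!%:R) = z.
    by rewrite /e4; field; rewrite n_neq0 fne0.
  have -> : (n - 2)`!%:R / 2 * g1 / (n%:R * (n - 2)`!%:R * g1) = 4^-1 * (2 / n%:R).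
    have f4 : 4 != 0 :> F by rewrite charF0.
    by field; rewrite n_neq0 fne0 g1n0 two_neq0 f4.
  have -> : e3 / (2 * n%:R * (n - 3)`!%:R * g2) = - 4^-1.
    have f4 : 4 != 0 :> F by rewrite charF0.
    by rewrite /e3; field; rewrite n_neq0 fne0 g2n0 two_neq0 f4.
  by apply/matrixP => i j; rewrite !mxE; ring.
have P11 : P1 *m P1 = P1.
  by rewrite -scalemxAl -scalemxAr K0_K0 scalerK.
have P22 : P2 *m P2 = P2.
  rewrite -scalemxAl -scalemxAr (K1_mul charF0 n_ge3) // q_h.
  by rewrite scalerK.
have P33 : P3 *m P3 = P3.
  rewrite -scalemxAl -scalemxAr (K2_mul charF0 n_ge3) // p_p.
  by rewrite scalerK.
have QQ : Q *m Q = Q.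
  by rewrite -scalemxAl -scalemxAr Kfix_Kfix scalerK.
have QP2 : Q *m P2 = P2.
  by rewrite -scalemxAr -scalemxAl Kfix_K1 // scalerK.
have P2Q : P2 *m Q = P2.
  by rewrite -scalemxAl -scalemxAr K1_Kfix // scalerK.
have QP1 : Q *m P1 = 0 by rewrite -scalemxAl -scalemxAr Kfix_K0 !scaler0.
have P1Q : P1 *m Q = 0 by rewrite -scalemxAl -scalemxAr K0_Kfix !scaler0.
have QP3 : Q *m P3 = 0 by rewrite -scalemxAl -scalemxAr Kfix_K2 ?scaler0.
have P3Q : P3 *m Q = 0 by rewrite -scalemxAl -scalemxAr K2_Kfix ?scaler0.
have P12 : P1 *m P2 = 0 by rewrite -scalemxAl -scalemxAr (K0_K1 charF0) ?scaler0.
have P21 : P2 *m P1 = 0 by rewrite -scalemxAl -scalemxAr (K1_K0 charF0) ?scaler0.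
have P13 : P1 *m P3 = 0.
  by rewrite -scalemxAl -scalemxAr (K0_K2 charF0) ?scaler0 //; case: pw.
have P31 : P3 *m P1 = 0.
  by rewrite -scalemxAl -scalemxAr (K2_K0 charF0) ?scaler0 //; case: pw'.
have P23 : P2 *m P3 = 0 by rewrite -scalemxAl -scalemxAr (K1_K2 charF0) ?scaler0.
have P32 : P3 *m P2 = 0 by rewrite -scalemxAl -scalemxAr (K2_K1 charF0) ?scaler0.
pose P (i : 'I_4) := nth 0 [:: P1; P2; P3; P4] i.
pose e (i : 'I_4) := nth 0 [:: e1; e2; e3; e4] i.
pose mu (i : 'I_4) := nth 0%N [:: 1; n - 1; 'C(n - 1, 2); (n - 1) * (n - 2)]%N i.
have mE : (\sum_i mu i = m)%N.
  by rewrite !big_ord_recl big_ord0 addn0 /mu /m /= !addnA.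
have trP i : \tr (P i) = (mu i)%:R.
  have t2 : \tr P2 = n%:R - 1.
    rewrite linearZ /= trace_K1 -/g1 factn0 factn1; field.
    by rewrite n_neq0 fne0 g1n0.
  have tQ : \tr Q = (n%:R - 1) * (n%:R - 1).
    rewrite linearZ /= trace_Kfix factn0 factn1; field.
    by rewrite n_neq0 fne0.
  case: i => [[|[|[|[|i]]]] lti] //; rewrite /P /mu /=.
  - by rewrite linearZ /= trace_K0 mulVf.
  - by rewrite t2 natr_n1.
  (* Doubling turns the binomial coefficient into a product. *)
  - apply: (mulIf two_neq0).
    rewrite -natrM double_bin2 -subnDA natrM natr_n1 natr_n2.
    rewrite linearZ /= trace_K2 -/g2 factn0 factn1 factn2; field.
    by rewrite n_neq0 fne0 g2n0 two_neq0.
  - by rewrite raddfB /= -/(mxtrace _) tQ t2 natrM natr_n1 natr_n2; ring.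
have e_inj : injective e.
  move=> i j /eqP; rewrite /e nth_uniq ?size_tuple //; last first.
    move: ue; rewrite -[X in uniq X]/(rcons [:: e1; e2; e3; e4] 0).
    by rewrite rcons_uniq => /andP[].
  by move=> /eqP/val_inj.
have e_n0 i : e i != 0.
  move: ue; rewrite -[_ :: _]/(rcons [:: e1; e2; e3; e4] 0).
  rewrite rcons_uniq => /andP[ni _].
  by apply: contraNneq ni => <-; rewrite mem_nth.
have PP i j : P i *m P j = if i == j then P i else 0.
  rewrite -val_eqE /P; case: i => [[|[|[|[|i]]]] lti];
    case: j => [[|[|[|[|j]]]] ltj] //=;
  by rewrite ?(mulmxBl, mulmxBr) ?(P11, P12, P13, P21, P22, P23, P31, P32, P33,
      QQ, QP1, QP2, QP3, P1Q, P2Q, P3Q) ?(subrr, subr0).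
have [] := orthogonal_idempotents charF0 e_inj e_n0 PP trP.
  by rewrite mE card_Sn ltnW.
have -> : \sum_i e i *: P i = M.
  by rewrite ME !big_ord_recl big_ord0 /e /P /= addr0 !addrA.
rewrite mE => dM eM mM mN.
have m0 : multiplicity M 0 = (n`! - m)%N.
  by rewrite mN; congr (_ - _)%N; apply: card_Sn.
pose o k (lt4 : (k < 4)%N) := Ordinal lt4.
have m1 : multiplicity M e1 = 1%N := mM (@o 0%N isT).
have m2 : multiplicity M e2 = (n - 1)%N := mM (@o 1%N isT).
have m3 : multiplicity M e3 = 'C(n - 1, 2) := mM (@o 2%N isT).
have m4 : multiplicity M e4 = ((n - 1) * (n - 2))%N := mM (@o 3%N isT).
split=> // a; split.
  case/eM => [->|[i ->]]; first by rewrite !inE eqxx !orbT.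
  rewrite -[_ :: _]/(rcons [:: e1; e2; e3; e4] 0) mem_rcons inE.
  by rewrite /e mem_nth ?orbT.
(* Conversely, positive multiplicity makes each listed value an eigenvalue; for 0 this is the strict
   bound on [m]. *)
have mult_eig b : (0 < multiplicity M b)%N -> eigenvalue M b.
  rewrite /multiplicity eigenvalue_root_char => mb.
  by apply: contraLR mb => /mupNroot->.
rewrite !inE => /or4P[||/eqP->|/orP[]] => [/eqP->|/eqP->||/eqP->|/eqP->].
- by apply: mult_eig; rewrite m1.
- by apply: mult_eig; rewrite m2.
- by apply: mult_eig; rewrite m3.
- by apply: mult_eig; rewrite m4.
- by apply: mult_eig; rewrite m0 subn_gt0.
Qed.

End CenteredKernels.

(** * Weighted inversion sums as pair kernels *)

Section Inversions.

Variables (F : fieldType) (n : nat).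
Hypothesis charF0 : forall k, (k%:R == 0 :> F) = (k == 0)%N.
Hypothesis n_ge3 : (2 < n)%N.

Definition order_sign (a b : 'I_n) : F := (a < b)%:R - (b < a)%:R.

Lemma antisym_order_sign : antisym order_sign.
Proof. by move=> a b; rewrite opprB. Qed.

(** Counting from 0, there are n - 1 - a indices above [a] and a below. *)
Lemma rowsum_order_sign a : rowsum order_sign a = n%:R - 1 - 2 * a%:R.
Proof.
have S (P : pred nat) : \sum_(b < n) (P b)%:R = (count P (iota 0 n))%:R :> F.
  rewrite -(big_mkord xpredT (fun b => (P b)%:R)) /index_iota subn0.
  rewrite -sum1_count natr_sum [RHS]big_mkcond.
  by apply: eq_bigr => b _; case: (P b).
have lt_a := ltn_ord a.
rewrite /rowsum sumrB (S (fun b => a < b)%N) (S (fun b => b < a)%N).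
have cE m k : count (fun b => b < k)%N (iota 0 m) = minn m k.
  elim: m => [|m IH]; first by rewrite min0n.
  rewrite -addn1 iotaD count_cat IH /=.
  by case: (ltnP m k) => ?; lia.
have := count_predC (fun b => b < a.+1)%N (iota 0 n).
rewrite size_iota !cE (@eq_count _ (predC _) (fun b => a < b)%N); last first.
  by move=> b /=; rewrite -leqNgt.
rewrite (minn_idPr lt_a) (minn_idPr (ltnW lt_a)) => nE.
have -> : n%:R = a.+1%:R + (count (fun b => a < b)%N (iota 0 n))%:R :> F.
  by rewrite -natrD nE.
by rewrite -natr1; ring.
Qed.

Variables (E : finType) (c : E -> F) (l r : E -> 'I_n).
Hypothesis lt_lr : forall x, (l x < r x)%N.

(** [E] indexes the weights rather than the pairs, since x_i and y_(i,i+1) sit on the same pair and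
    must add up there. *)
Definition weight (a b : 'I_n) : F := \sum_x c x *
  ((l x == a)%:R * (r x == b)%:R - (r x == a)%:R * (l x == b)%:R).

Lemma antisym_weight : antisym weight.
Proof.
by move=> a b; rewrite -sumrN; apply: eq_bigr => x _; ring.
Qed.

Lemma dot2_weight w : dot2 w weight = \sum_x c x * (w (l x) (r x) - w (r x) (l x)).
Proof.
rewrite /dot2; under eq_bigr do under eq_bigr do rewrite mulr_sumr.
under eq_bigr do rewrite exchange_big.
rewrite exchange_big; apply: eq_bigr => x _ /=.
transitivity (c x *
  (\sum_a (l x == a)%:R * (\sum_b (r x == b)%:R * w a b)
   - \sum_a (r x == a)%:R * (\sum_b (l x == b)%:R * w a b))); last first.
  by rewrite !sum_delta.
rewrite -sumrB mulr_sumr; apply: eq_bigr => a _.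
rewrite !mulr_sumr -sumrB mulr_sumr; apply: eq_bigr => b _.
ring.
Qed.

Let W := \sum_x c x.
Let D := \sum_x c x * ((r x)%:R - (l x)%:R).

Lemma dot2_order_sign_weight : dot2 order_sign weight = 2 * W.
Proof.
rewrite dot2_weight mulr_sumr; apply: eq_bigr => x _.
by rewrite /order_sign lt_lr ltnNge (ltnW (lt_lr x)) /=; ring.
Qed.

Lemma dot1_rowsum_weight : dot1 (rowsum order_sign) (rowsum weight) = 2 * D.
Proof.
transitivity (dot2 (fun a _ => rowsum order_sign a) weight).
  by apply: eq_bigr => a _; rewrite mulr_sumr.
rewrite dot2_weight mulr_sumr; apply: eq_bigr => x _.
by rewrite !rowsum_order_sign; ring.
Qed.

(** The indicator of an inversion is (1 - eps)/2, and [dot2] counts each pair in both orientations,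
    hence 1/4. Reindexing by [t] separates [s] from [t]. *)
Lemma inversion_sumE (s t : 'S_n) :
  \sum_x c x * ((t^-1 * s)%g (r x) < (t^-1 * s)%g (l x))%:R
    = W / 2 - 4^-1 * dot2 (act2 order_sign s) (act2 weight t).
Proof.
set p := (t^-1 * s)%g.
have -> : dot2 (act2 order_sign s) (act2 weight t) = dot2 (act2 order_sign p) weight.
  rewrite {1}/dot2 -(sum_perm _ t^-1%g); apply: eq_bigr => a _.
  rewrite -(sum_perm _ t^-1%g); apply: eq_bigr => b _.
  by rewrite /act2 !permKV !permM.
rewrite dot2_weight mulr_suml mulr_sumr -sumrB; apply: eq_bigr => x _.
have f4 : 4 != 0 :> F by rewrite charF0.
have f2 : 2 != 0 :> F by rewrite charF0.
rewrite /act2 /order_sign.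
have : p (r x) != p (l x).
  by rewrite (inj_eq perm_inj) neq_ltn lt_lr orbT.
by rewrite neq_ltn => /orP[] lt_p; rewrite lt_p ltnNge (ltnW lt_p) /=; field;
  rewrite f2 f4.
Qed.

Lemma inversion_fix_spectrum (z : F) :
  let M := kernel_mx (fun s t : 'S_n =>
    \sum_x c x * ((t^-1 * s)%g (r x) < (t^-1 * s)%g (l x))%:R
    + z * #|Fix (t^-1 * s)%g|%:R) in
  let e1 := n`!%:R / 2 * W + n`!%:R * z in
  let e2 := - ((n - 2)`!%:R * (D - n%:R * z)) in
  let e3 := - ((n - 3)`!%:R * (n%:R * W - 2 * D)) in
  let e4 := (n - 2)`!%:R * n%:R * z in
  uniq [:: e1; e2; e3; e4; 0] ->
  let m := (1 + (n - 1) + 'C(n - 1, 2) + (n - 1) * (n - 2))%N in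
  (m < n`!)%N ->
  [/\ diagonalizable M,
      (forall a, eigenvalue M a <-> a \in [:: e1; e2; e3; e4; 0])
    & [/\ multiplicity M e1 = 1%N,
          multiplicity M e2 = (n - 1)%N,
          multiplicity M e3 = 'C(n - 1, 2),
          multiplicity M e4 = ((n - 1) * (n - 2))%N
        & multiplicity M 0 = (n`! - m)%N]].
Proof.
move=> M e1 e2 e3 e4 ue m lt_m.
have f2 : 2 != 0 :> F by rewrite charF0.
have fn : n%:R != 0 :> F by rewrite charF0; lia.
(* The z added to W/2 restores the 1 subtracted in [Kfix]. *)
have := @kernel_spectrum F n charF0 n_ge3 order_sign weight (W / 2 + z) z
  antisym_order_sign antisym_weight; cbv zeta.
have -> : (W / 2 + z) *: K0 F n + z *: Kfix F n
    - 4%:R^-1 *: K2 order_sign weight = M.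
  apply/matrixP=> i j; rewrite !mxE inversion_sumE.
  set s := enum_val i; set t := enum_val j.
  have -> : #|Fix (t^-1 * s)%g|%:R = \sum_a (s a == t a)%:R :> F.
    rewrite -sum1_card natr_sum big_mkcond -(sum_perm _ t) /=.
    apply: eq_bigr => a _; rewrite inE permM permK.
    by case: (_ == _).
  ring.
rewrite dot1_rowsum_weight.
have -> : dot2 (center order_sign) (center weight) = 2 * W - 4 / n%:R * D.
  have := dot2_center charF0 n_ge3 antisym_order_sign antisym_weight.
  rewrite dot2_order_sign_weight dot1_rowsum_weight => ->.
  ring.
have -> : n`!%:R * (W / 2 + z) = e1 by rewrite /e1; field.
have -> : n%:R * (n - 2)`!%:R * z - (n - 2)`!%:R / 2 * (2 * D) = e2.
  by rewrite /e2; field.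
have -> : - (n%:R / 2 * (n - 3)`!%:R * (2 * W - 4 / n%:R * D)) = e3.
  by rewrite /e3; field; rewrite f2 fn.
have -> : n%:R * (n - 2)`!%:R * z = e4 by rewrite /e4; ring.
by apply.
Qed.

End Inversions.

(** * Characteristic, dimension count and distinctness for the actual eigenvalues *)

Lemma fraction_mpoly_char0 (R : realType) (k m : nat) :
  (m%:R == 0 :> {fraction {mpoly R[k]}}) = (m == 0)%N.
Proof.
rewrite -(rmorph_nat (@tofrac {mpoly R[k]})) tofrac_eq0.
by rewrite -(rmorph_nat (@mpolyC k R)) mpolyC_eq0 pnatr_eq0.
Qed.

(** This leaves room for the eigenvalue 0; at n = 3 both sides would be 6. *)
Lemma spectrum_dim_lt_fact n : (4 <= n)%N ->
  (1 + (n - 1) + 'C(n - 1, 2) + (n - 1) * (n - 2) < n`!)%N.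
Proof.
move=> n4; have b2 : ('C(n - 1, 2) * 2 = (n - 1) * (n - 2))%N.
  by rewrite double_bin2 -subnDA.
have f1 : (n`! = n * (n - 1) * (n - 2)`!)%N.
  by rewrite (@fact_subn1 n) 1?(@fact_subn1 (n - 1)) -?subnDA ?mulnA //; lia.
have f2 : ((n - 2)`! >= 2)%N by apply: leq_trans (fact_geq _); lia.
nia.
Qed.

Section EigDistinct.

Variables (R : realType) (n : nat).
Hypothesis hn : (4 <= n)%N.

(** Two evaluations separate the list: z = 1 and all else 0 ([vz]), and all x_i = 1 and all else 0
    ([vx]). With [k] and [j] as below, the pairs of values are (n!, n!(n-1)/2), (k, -j), (0, -j),
    (k, 0), (0, 0). *)
Lemma uniq_eig : uniq [:: eig1 R n; eig2 R n; eig3 R n; eig4 R n; 0].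
Proof.
pose vz (k : 'I_#|indet n|) : R := if enum_val k is None then 1 else 0.
pose vx (k : 'I_#|indet n|) : R := if enum_val k is Some (inl _) then 1 else 0.
have Xz i : (X R i).@[vz] = 0 by rewrite mevalXU /vz enum_rankK.
have Yz p : (Y R p).@[vz] = 0 by rewrite mevalXU /vz enum_rankK.
have Zz : (Z R n).@[vz] = 1 by rewrite mevalXU /vz enum_rankK.
have Xx i : (X R i).@[vx] = 1 by rewrite mevalXU /vx enum_rankK.
have Yx p : (Y R p).@[vx] = 0 by rewrite mevalXU /vx enum_rankK.
have Zx : (Z R n).@[vx] = 0 by rewrite mevalXU /vx enum_rankK.
have natE v k : (k%:R : polyring R n).@[v] = k%:R by rewrite rmorph_nat.
have sXz : (\sum_i X R i).@[vz] = 0 :> R.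
  by rewrite raddf_sum big1 // => i _; apply: Xz.
have sXx : (\sum_i X R i).@[vx] = (n - 1)%:R :> R.
  rewrite raddf_sum (eq_bigr (fun=> 1)) => [|i _]; last exact: Xx.
  by rewrite sumr_const card_ord subn1.
have sYz (f : opair n -> polyring R n) : (\sum_p f p * Y R p).@[vz] = 0 :> R.
  by rewrite raddf_sum big1 // => p _; rewrite /= mevalM Yz mulr0.
have sYx (f : opair n -> polyring R n) : (\sum_p f p * Y R p).@[vx] = 0 :> R.
  by rewrite raddf_sum big1 // => p _; rewrite /= mevalM Yx mulr0.
have s1z : (\sum_p Y R p).@[vz] = 0 :> R.
  by rewrite raddf_sum big1 // => p _; apply: Yz.
have s1x : (\sum_p Y R p).@[vx] = 0 :> R.
  by rewrite raddf_sum big1 // => p _; apply: Yx.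
pose evE := (mevalD, mevalB, mevalN, mevalM, mevalZ, natE, sXz, sXx, sYz, sYx,
  s1z, s1x, Zz, Zx).
pose k : R := n%:R * (n - 2)`!%:R.
pose j : R := (n - 2)`!%:R * (n - 1)%:R.
have e1z : (eig1 R n).@[vz] = n`!%:R by rewrite /eig1 !evE; ring.
have e2z : (eig2 R n).@[vz] = k by rewrite /eig2 !evE /k; ring.
have e3z : (eig3 R n).@[vz] = 0 by rewrite /eig3 !evE; ring.
have e4z : (eig4 R n).@[vz] = k by rewrite /eig4 !evE /k; ring.
have e1x : (eig1 R n).@[vx] = n`!%:R / 2 * (n - 1)%:R by rewrite /eig1 !evE; ring.
have e2x : (eig2 R n).@[vx] = - j by rewrite /eig2 !evE /j; ring.
have e3x : (eig3 R n).@[vx] = - j by rewrite /eig3 !evE /j; ring.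
have e4x : (eig4 R n).@[vx] = 0 by rewrite /eig4 !evE; ring.
have k0 : 0 < k by rewrite mulr_gt0 ?ltr0n ?fact_gt0 //; lia.
have j0 : 0 < j by rewrite mulr_gt0 ?ltr0n ?fact_gt0 //; lia.
have n0 : 0 < n`!%:R :> R by rewrite ltr0n fact_gt0.
have h0 : 0 < n`!%:R / 2 * (n - 1)%:R :> R.
  by rewrite !mulr_gt0 ?invr_gt0 ?ltr0n ?fact_gt0 //; lia.
have nj0 : - j < 0 by rewrite oppr_lt0.
have vne v (p q : polyring R n) : p.@[v] != q.@[v] -> p != q.
  by apply: contra_neq => ->.
rewrite /= !inE !negb_or !andbT.
apply/and4P; split; [apply/and4P; split|apply/and3P; split|apply/andP; split|].
- by apply: (vne vx); rewrite e1x e2x gt_eqF // (lt_trans nj0 h0).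
- by apply: (vne vz); rewrite e1z e3z gt_eqF.
- by apply: (vne vx); rewrite e1x e4x gt_eqF.
- by apply: (vne vx); rewrite e1x meval0 gt_eqF.
- by apply: (vne vz); rewrite e2z e3z gt_eqF.
- by apply: (vne vx); rewrite e2x e4x lt_eqF.
- by apply: (vne vx); rewrite e2x meval0 lt_eqF.
- by apply: (vne vz); rewrite e3z e4z lt_eqF.
- by apply: (vne vx); rewrite e3x meval0 lt_eqF.
- by apply: (vne vz); rewrite e4z meval0 gt_eqF.
Qed.

End EigDistinct.

Theorem corollary1p2 (R : realType) (n : nat) (hn : (4 <= n)%N) :
  let M := DIF R n in
  let e1 := tofrac (eig1 R n) in
  let e2 := tofrac (eig2 R n) in
  let e3 := tofrac (eig3 R n) in
  let e4 := tofrac (eig4 R n) in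
  [/\ diagonalizable M,
      uniq [:: e1; e2; e3; e4; 0],
      (forall a, eigenvalue M a <-> a \in [:: e1; e2; e3; e4; 0])
    & [/\ multiplicity M e1 = 1%N,
          multiplicity M e2 = (n - 1)%N,
          multiplicity M e3 = 'C(n - 1, 2),
          multiplicity M e4 = ((n - 1) * (n - 2))%N
        & multiplicity M 0 = (n`! - (n * (3 * n - 7)) %/ 2 - 3)%N]].
Proof.
move=> M e1 e2 e3 e4.
pose F := {fraction (polyring R n)}.
pose tf := @tofrac (polyring R n).
have charF0 := @fraction_mpoly_char0 R #|indet n|.
have tf_nat k : tf k%:R = k%:R by exact: rmorph_nat.
have tfD : {morph tf : p q / p + q} := @tofracD _.
have tfB : {morph tf : p q / p - q} := @tofracB _.
have tfM : {morph tf : p q / p * q} := @tofracM _.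
have tfN : {morph tf : p / - p} := @tofracN _.
have uE : uniq [:: e1; e2; e3; e4; 0].
  rewrite -(tofrac0 (polyring R n)).
  rewrite -[X in uniq X]/(map tf [:: eig1 R n; eig2 R n; eig3 R n; eig4 R n; 0]).
  rewrite map_inj_uniq; first exact: uniq_eig.
  by move=> p q /eqP; rewrite tofrac_eq => /eqP.
(* A descent is an inversion of an adjacent pair, so the x_i and the y_(i,j) are both weights on
   pairs. *)
pose E := ('I_n.-1 + opair n)%type.
pose c (x : E) : F := match x with inl i => tf (X R i) | inr p => tf (Y R p) end.
pose l (x : E) := match x with inl i => posn i | inr p => lo p end.
pose r (x : E) := match x with inl i => posS i | inr p => hi p end.
have lt_lr x : (l x < r x)%N by case: x => [i|p] //=; apply: (valP p).
have big_E (f : E -> F) : \sum_x f x = \sum_i f (inl i) + \sum_p f (inr p).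
  exact: big_sumType.
have := @inversion_fix_spectrum F n charF0 (ltnW hn) E c l r lt_lr
  (tf (Z R n)).
cbv zeta.
set M' := kernel_mx _.
have -> : M' = M.
  apply/matrixP => i j; rewrite !mxE.
  set s := (_ * _)%g.
  rewrite /dif /des_x /inv_y /fix_z !tofracD tofracMn !raddf_sum big_E /=.
  congr (_ + _ + _); last by rewrite mulr_natr.
    rewrite [RHS]big_mkcond; apply: eq_bigr => x _ /=.
    by rewrite inE; case: ifP => _; rewrite ?mulr1 ?mulr0.
  rewrite [RHS]big_mkcond; apply: eq_bigr => x _ /=.
  by rewrite inE; case: ifP => _; rewrite ?mulr1 ?mulr0.
pose sX := \sum_i tf (X R i).
pose sY := \sum_p tf (Y R p).
pose sD := \sum_p ((hi p)%:R - (lo p)%:R) * tf (Y R p).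
have -> : \sum_x c x = sX + sY by rewrite big_E.
(* Adjacent positions differ by 1, so each x_i counts once in D. *)
have -> : \sum_x c x * ((r x)%:R - (l x)%:R) = sX + sD.
  rewrite big_E; congr (_ + _); apply: eq_bigr => x _ /=.
    by rewrite -natr1; ring.
  by rewrite mulrC.
have tX : tf (\sum_i X R i) = sX by exact: raddf_sum.
have tY : tf (\sum_p Y R p) = sY by exact: raddf_sum.
have tD : tf (\sum_p ((hi p)%:R - (lo p)%:R) * Y R p) = sD.
  rewrite /tf raddf_sum; apply: eq_bigr => p _ /=.
  by rewrite tofracM tofracB -/tf !tf_nat.
have f2 : 2 != 0 :> F by rewrite charF0.
have -> : n`!%:R / 2 * (sX + sY) + n`!%:R * tf (Z R n) = e1.
  rewrite /e1 /eig1 -mul_mpolyC -/tf tfD !tfM tf_nat tfD tX tY.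
  (* [eig1] halves in [R], the left-hand side in the fraction field; multiplying by 2 compares
     them. *)
  congr (_ * _ + _); apply: (mulIf f2); rewrite divfK //.
  transitivity (tf ((n`!%:R / 2)%:MP * 2%:R)); last by rewrite tfM tf_nat.
  rewrite -(rmorph_nat (@mpolyC #|indet n| R) 2) -mpolyCM divfK ?pnatr_eq0 //.
  by rewrite rmorph_nat tf_nat.
have -> : - ((n - 2)`!%:R * (sX + sD - n%:R * tf (Z R n))) = e2.
  by rewrite /e2 /eig2 -/tf tfN tfM tfB tfD tfM !tf_nat tX tD.
have -> : - ((n - 3)`!%:R * (n%:R * (sX + sY) - 2 * (sX + sD))) = e3.
  rewrite /e3 /eig3 -/tf tfB tfN !tfM !tf_nat tX.
  have -> : tf (\sum_p (n%:R - 2%:R * ((hi p)%:R - (lo p)%:R)) * Y R p)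
      = n%:R * sY - 2 * sD.
    rewrite /tf raddf_sum !mulr_sumr -sumrB; apply: eq_bigr => p _ /=.
    by rewrite -/tf tfM tfB tfM tfB !tf_nat; ring.
  (* The coefficient of x_i in nW - 2D is n - 2, which combines with (n-3)!. *)
  have -> : (n - 2)`!%:R = (n%:R - 2) * (n - 3)`!%:R :> F.
    by rewrite (@fact_subn1 (n - 2)) -?subnDA ?natrM ?natrB //; lia.
  ring.
have -> : (n - 2)`!%:R * n%:R * tf (Z R n) = e4.
  by rewrite /e4 /eig4 -/tf !tfM !tf_nat.
move=> /(_ uE (spectrum_dim_lt_fact hn)) [dM eM [m1 m2 m3 m4 m0]].
split=> //; split=> //; rewrite m0.
have b2 : ('C(n - 1, 2) * 2 = (n - 1) * (n - 2))%N.
  by rewrite double_bin2 -subnDA.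
rewrite -subnDA; congr (_ - _)%N.
(* This exhibits the division by 2 as exact. *)
have -> : (n * (3 * n - 7) = (n - 1 + 'C(n - 1, 2) + (n - 1) * (n - 2) - 2) * 2)%N.
  nia.
rewrite mulnK //; nia.
Qed.
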